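(* Let $U$ be an open domain in $\mathbb R^n$ and let $U\subseteq\bigcup_i D_i$ be a finite closed cover such that each $D_i$ is a convex polytope. Suppose $V(x)$ is a $C^1$ vector field on $U$ and is analytic on each $D_i\cap U$. If $x(t)$ is a curve in $U$, defined for $t$ near $0$, with $x'(t)=V(x(t))$ for $t$ near $0$, then there exists $\epsilon>0$ such that $x([0,\epsilon))\subseteq D_i$ for some $i$.
   Context: A half space in $\mathbb R^n$ is a set $\{x\in\mathbb R^n:a_1x_1+\dots+a_nx_n\ge b\}$ with $(a_1,\dots,a_n)\in\mathbb R^n$ nonzero and $b\in\mathbb R$. A convex polytope is a subset $D\subseteq\mathbb R^n$ with nonempty interior that is the intersection of finitely many half spaces (it need not be bounded). A vector field on $U\subseteq\mathbb R^n$ is a function $U\to\mathbb R^n$. A function $f$ on an arbitrary subset $W\subseteq\mathbb R^n$ is called analytic if there exist an open superset $\tilde W$ of $W$ and a (real-)analytic function $\tilde f$ on $\tilde W$ with $\tilde f\equiv f$ on $W$. *)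

(* Defs.v *)
From HB Require Import structures.
From mathcomp Require Import all_boot all_order all_algebra.
From mathcomp Require Import all_classical all_reals all_analysis.
From mathcomp.analysis.showcase Require summability.

Set Implicit Arguments.
Unset Strict Implicit.
Unset Printing Implicit Defensive.

Import Order.TTheory GRing.Theory Num.Theory.
Import numFieldNormedType.Exports.

Local Open Scope classical_set_scope.
Local Open Scope ring_scope.

Section Defs.
Context {R : realType}.

Definition half_space n (H : set 'rV[R]_n) : Prop :=
  exists (a : 'rV[R]_n) (b : R),
    a != 0 /\ H = [set x | b <= \sum_(i < n) a 0 i * x 0 i].

(* k = 0 is allowed: the whole space is a convex polytope. *)
Definition convex_polytope n (D : set 'rV[R]_n) : Prop :=
  interior D !=set0 /\
  exists (k : nat) (H : 'I_k -> set 'rV[R]_n),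
    (forall j, half_space (H j)) /\ D = \bigcap_j H j.

Definition monomial n (alpha : {ffun 'I_n -> nat}) (h : 'rV[R]_n) : R :=
  \prod_(i < n) h 0 i ^+ alpha i.

(* Convergence of the multi-index series is unconditional: it is the limit of
   the net of sums over all finite sets of multi-indices. In finite dimension
   this is the same as absolute convergence. *)
Definition analytic_at n m (f : 'rV[R]_n -> 'rV[R]_m) (p : 'rV[R]_n) : Prop :=
  exists c : {ffun 'I_n -> nat} -> 'rV[R]_m,
    \forall y \near p,
      summability.partial_sum (fun alpha => monomial alpha (y - p) *: c alpha)
        @ summability.totally --> f y.

(* W is an arbitrary set; f matters only through its values on W. *)
Definition analytic_on n m (f : 'rV[R]_n -> 'rV[R]_m) (W : set 'rV[R]_n) :
    Prop :=
  exists (W' : set 'rV[R]_n) (g : 'rV[R]_n -> 'rV[R]_m),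
    [/\ open W', W `<=` W', (forall p, W' p -> analytic_at g p)
      & forall p, W p -> g p = f p].

(* Meant for open U, where the values of f outside U are irrelevant. *)
Definition C1_on n m (f : 'rV[R]_n -> 'rV[R]_m) (U : set 'rV[R]_n) : Prop :=
  forall p, U p -> differentiable f p /\ {for p, continuous (jacobian f)}.

End Defs.

(* Main.v *)
Require Import Defs.
From HB Require Import structures.
From mathcomp Require Import all_boot all_order all_algebra finmap.
From mathcomp Require Import all_classical all_reals all_analysis.
From mathcomp Require Import lra ring.
From mathcomp.analysis.showcase Require summability.

(** The idea is to show that, to every order in time, the trajectory has one
    Taylor expansion, and that this expansion can be computed inside any single
    piece that the trajectory keeps meeting.

    Let [g i] be the analytic extension of [V] from the piece [D i], and call
    the piece visited when [x t] lies in it for arbitrarily small [t > 0].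
    Every visited piece contains [x 0], because it is closed. For each of these
    pieces the initial value problem [y' = g i y], [y 0 = x 0] has polynomial
    approximate solutions [P i N] of degree at most [N], whose defect is at most
    [C * (C * t) ^ N], with a constant [C] that depends neither on [N] nor on
    the piece ([analytic_approx_solvable]). The uniformity in [N] is where
    analyticity enters. It comes from a Picard iteration on polynomials that
    stays in a ball of a weighted l1 norm; that norm is submultiplicative, so
    substituting a polynomial into a power series is controlled by the absolute
    sums of the series.

    All visited pieces have the same [P i N], by induction on [N]
    ([jets_agree]). If they agree at order [N], a Gronwall estimate gives
    [x t - P i N t = O(t ^ N.+1)], whichever visited piece [x t] lies in
    ([common_jet_approximates]). At the times when [x t] lies in both [D i] and
    [D j], the velocities of [P i N.+1] and [P j N.+1] therefore both differ
    from [V (x t)] by [O(t ^ N.+1)]; these velocities are polynomials of degree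
    at most [N], so if such times accumulate at [0] they are equal. Since an
    interval of times is connected and the pieces are closed, any two visited
    pieces are joined by a chain of pairs met in this way
    ([closed_cover_chain]).

    Consequently an affine function [f] of [x t] is approximated by polynomials
    in [t] of degree at most [N] with error at most [K * (B * t) ^ N.+1],
    uniformly in [N]. Either all of them vanish, and then [f = 0] for small
    [t >= 0] on letting [N] grow, or a lowest term decides the sign of [f]
    ([eventually_constant_sign]). For an inequality defining a visited piece,
    the sign cannot be negative for all small [t > 0], so it is nonnegative.
    Each visited piece thus contains [x t] for all small [t >= 0]. *)

Set Implicit Arguments.
Unset Strict Implicit.
Unset Printing Implicit Defensive.

Import Order.TTheory GRing.Theory Num.Theory.
Import numFieldNormedType.Exports.

Local Open Scope classical_set_scope.
Local Open Scope ring_scope.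

(** * Weighted l1 norms of polynomials *)

Section WeightedNorm.
Context {R : realType}.
Implicit Types (p q : {poly R}) (w t : R).

Definition wnorm w p : R := \sum_(i < size p) `|p`_i| * w ^+ i.

Lemma wnormE w p N : (size p <= N)%N ->
  wnorm w p = \sum_(i < N) `|p`_i| * w ^+ i.
Proof.
move=> pN; rewrite /wnorm (big_ord_widen N (fun i => `|p`_i| * w ^+ i) pN).
rewrite big_mkcond; apply: eq_bigr => i _; case: ltnP => // ip.
by rewrite nth_default ?normr0 ?mul0r.
Qed.

Lemma wnorm_ge0 w p : 0 <= w -> 0 <= wnorm w p.
Proof.
by move=> w0; apply: sumr_ge0 => i _; rewrite mulr_ge0 ?exprn_ge0.
Qed.

Lemma wnorm0 w : wnorm w 0 = 0.
Proof. by rewrite /wnorm size_poly0 big_ord0. Qed.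

Lemma ler_wnorm w p q : 0 <= w -> (forall i, `|p`_i| <= `|q`_i|) ->
  wnorm w p <= wnorm w q.
Proof.
move=> w0 pq; pose N := maxn (size p) (size q).
rewrite (@wnormE _ p N) ?leq_maxl // (@wnormE _ q N) ?leq_maxr //.
by apply: ler_sum => i _; rewrite ler_wpM2r ?exprn_ge0.
Qed.

Lemma ler_wnormD w p q : 0 <= w -> wnorm w (p + q) <= wnorm w p + wnorm w q.
Proof.
move=> w0; pose N := maxn (size p) (size q).
rewrite (@wnormE _ p N) ?leq_maxl // (@wnormE _ q N) ?leq_maxr //.
rewrite (@wnormE _ (p + q) N) ?size_polyD // -big_split /=.
apply: ler_sum => i _; rewrite -mulrDl ler_wpM2r ?exprn_ge0 //.
by rewrite coefD ler_normD.
Qed.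

Lemma wnormN w p : wnorm w (- p) = wnorm w p.
Proof.
by rewrite /wnorm size_polyN; apply: eq_bigr => i _; rewrite coefN normrN.
Qed.

Lemma ler_wnorm_sum (I : Type) (s : seq I) (F : I -> {poly R}) w : 0 <= w ->
  wnorm w (\sum_(i <- s) F i) <= \sum_(i <- s) wnorm w (F i).
Proof.
move=> w0; elim/big_ind2: _ => [|x p y q xp yq|//]; first by rewrite wnorm0.
by rewrite (le_trans (ler_wnormD _ _ w0)) ?lerD.
Qed.

Lemma wnormZ w c p : wnorm w (c *: p) = `|c| * wnorm w p.
Proof.
rewrite (@wnormE _ _ (size p)) ?size_scale_leq // /wnorm mulr_sumr.
by apply: eq_bigr => i _; rewrite coefZ normrM mulrA.
Qed.

(** The recursion behind Horner's scheme, which makes submultiplicativity an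
    induction on the first factor. *)
Lemma wnorm_MXaddC w p c : wnorm w (p * 'X + c%:P) = w * wnorm w p + `|c|.
Proof.
rewrite (@wnormE _ _ (size p).+1); last first.
  by rewrite size_MXaddC; case: ifP.
rewrite big_ord_recl /= coefD coefMX coefC /= add0r mulr1 addrC.
congr (_ + _); rewrite /wnorm mulr_sumr; apply: eq_bigr => i _.
by rewrite coefD coefMX coefC /= addr0 exprS mulrCA.
Qed.

Lemma wnormMX w p : wnorm w (p * 'X) = w * wnorm w p.
Proof. by rewrite -[p * 'X]addr0 -polyC0 wnorm_MXaddC normr0 addr0. Qed.

Lemma ler_wnormM w p q : 0 <= w -> wnorm w (p * q) <= wnorm w p * wnorm w q.
Proof.
move=> w0; elim/poly_ind: p => [|p c IH]; first by rewrite mul0r !wnorm0 mul0r.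
rewrite wnorm_MXaddC mulrDl mul_polyC [p * _ * q]mulrAC mulrDl.
rewrite (le_trans (ler_wnormD _ _ w0)) // wnormMX wnormZ lerD2r -mulrA.
by rewrite ler_wpM2l.
Qed.

Lemma wnorm1 w : wnorm w 1 = 1.
Proof. by rewrite /wnorm size_poly1 big_ord1 coef1 normr1 mul1r. Qed.

Lemma ler_wnorm_monomial (I : finType) (P : I -> {poly R}) (a : I -> nat) w r :
  0 <= w -> (forall i, wnorm w (P i) <= r) ->
  wnorm w (\prod_i P i ^+ a i) <= r ^+ (\sum_i a i).
Proof.
move=> w0 Pr; rewrite -prodrXr; elim/big_ind2: _ => [|p x q y px qy|i _].
- by rewrite wnorm1.
- rewrite (le_trans (ler_wnormM _ _ w0)) // ler_pM ?wnorm_ge0 //.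
- elim: (a i) => [|k IH]; first by rewrite wnorm1.
  rewrite !exprS (le_trans (ler_wnormM _ _ w0)) // ler_pM ?wnorm_ge0 //.
Qed.

(** A polynomial divisible by ['X^N] is small of order [N] at [0], with a
    constant that only involves its weighted norm. *)
Lemma ler_horner_wnorm w p N t : 0 < w -> 0 <= t <= w ->
  (forall i, (i < N)%N -> p`_i = 0) -> `|p.[t]| <= wnorm w p * (t / w) ^+ N.
Proof.
move=> w0 /andP[t0 tw] pN; rewrite horner_coef.
rewrite (le_trans (ler_norm_sum _ _ _)) // /wnorm mulr_suml; apply: ler_sum => i _.
have tw0 : 0 <= t / w by rewrite divr_ge0 // ltW.
have tw1 : t / w <= 1 by rewrite ler_pdivrMr ?mul1r.
have [iN|Ni] := ltnP i N; first by rewrite pN // mul0r normr0 !mul0r.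
rewrite normrM normrX (ger0_norm t0) -mulrA ler_wpM2l //.
rewrite -[t in t ^+ i](divfK (lt0r_neq0 w0)) exprMn mulrC.
by apply: ler_wpM2l; [exact/exprn_ge0/ltW|exact: ler_wiXn2l].
Qed.

(** Congruence modulo ['X^N]. *)
Definition eqcoef N p q := forall i, (i < N)%N -> p`_i = q`_i.

Lemma eqcoefM N p p' q q' : eqcoef N p p' -> eqcoef N q q' ->
  eqcoef N (p * q) (p' * q').
Proof.
move=> pp qq i iN; rewrite !coefM; apply: eq_bigr => j _.
by rewrite pp ?qq //; [apply: leq_ltn_trans iN; exact: leq_subr|
  apply: leq_trans iN; exact: ltn_ord].
Qed.

End WeightedNorm.

(** * Polynomial solutions of polynomial systems up to a given order *)

Section PolySolution.
Context {R : realType} {n : nat}.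
Variables (J : seq {ffun 'I_n -> nat}) (c : {ffun 'I_n -> nat} -> 'I_n -> R).
Implicit Types (P Q : 'I_n -> {poly R}).

(** One component of the vector field [sum c a * y ^ a], truncated to the
    exponents in [J], with the polynomials [P] substituted for [y]. *)
Definition comp_field P (k : 'I_n) : {poly R} :=
  \sum_(a <- J) c a k *: \prod_i P i ^+ a i.

(** The primitive of [comp_field P k] vanishing at [0], cut at degree [N]. The
    convention [0^-1 = 0] makes the constant term vanish. *)
Definition picard N P (k : 'I_n) : {poly R} :=
  \poly_(i < N.+1) ((comp_field P k)`_i.-1 / i%:R).

Lemma comp_field_eqcoef N P Q k : (forall i, eqcoef N (P i) (Q i)) ->
  eqcoef N (comp_field P k) (comp_field Q k).
Proof.
move=> PQ i iN; rewrite !coef_sum; apply: eq_bigr => a _; rewrite !coefZ.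
congr (_ * _); move: i iN; elim/big_ind2: _ => // [|j _].
  by move=> ? ? ? ?; exact: eqcoefM.
elim: (a j) => // m IH; rewrite !exprS; apply: eqcoefM => //; exact: PQ.
Qed.

(** Integration raises orders by one, so each Picard step settles one more
    coefficient. *)
Lemma picard_eqcoef N m P Q k : (forall i, eqcoef m (P i) (Q i)) ->
  eqcoef m.+1 (picard N P k) (picard N Q k).
Proof.
move=> PQ [|i] im; rewrite !coef_poly; first by rewrite invr0 !mulr0.
by rewrite (comp_field_eqcoef k PQ).
Qed.

Lemma coef_deriv_picard N P k i :
  (picard N P k)^`()`_i = if (i < N)%N then (comp_field P k)`_i else 0.
Proof.
rewrite coef_deriv coef_poly ltnS; case: ifP => _; last by rewrite mul0rn.
by rewrite -[LHS]mulr_natr divfK // pnatr_eq0.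
Qed.

(** Iterating [picard] from [0] fixes the coefficients up to degree [N] after
    finitely many steps. All iterates have norm at most [r]: the norm of the
    field is then at most [M], and integration multiplies norms by at most [w].
    Both norm bounds are independent of [N]. *)
Lemma poly_solution (w r M : R) N : 0 < w -> 0 <= r -> w * M <= r ->
  (forall k, \sum_(a <- J) `|c a k| * r ^+ (\sum_i a i) <= M) ->
  exists P : 'I_n -> {poly R}, forall k,
  [/\ (size (P k) <= N.+1)%N, (P k)`_0 = 0, wnorm w (P k) <= r,
    wnorm w ((P k)^`() - comp_field P k) <= 2 * M &
    eqcoef N (P k)^`() (comp_field P k)].
Proof.
move=> w0 r0 wM cM; have w0' := ltW w0.
have WM P : (forall k, wnorm w (P k) <= r) ->
    forall k, wnorm w (comp_field P k) <= M.
  move=> Pr k; apply: le_trans (cM k).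
  rewrite (le_trans (ler_wnorm_sum _ _ w0')) //; apply: ler_sum => a _.
  by rewrite wnormZ ler_wpM2l // ler_wnorm_monomial.
have TM P : (forall k, wnorm w (P k) <= r) ->
    forall k, wnorm w (picard N P k) <= r.
  move=> Pr k; apply: le_trans wM; apply: le_trans (ler_wpM2l w0' (WM _ Pr k)).
  rewrite -wnormMX; apply: ler_wnorm => // -[|i].
    by rewrite coef_poly invr0 mulr0 normr0.
  rewrite coef_poly coefMX /=; case: ifP => _; last by rewrite normr0.
  rewrite normrM [X in _ * X]ger0_norm ?invr_ge0 //.
  by rewrite ler_piMr // invf_le1 ?ltr0n // ler1n.
pose It s := iter s (picard N) (fun=> 0).
have Itr s : forall k, wnorm w (It s k) <= r.
  elim: s => [|s IH] k /=; first by rewrite wnorm0.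
  exact: TM.
have It0 s k : (It s k)`_0 = 0.
  by case: s => [|s] /=; rewrite ?coef0 // coef_poly invr0 mulr0.
have Iteq s : forall k, eqcoef s.+1 (It s k) (It s.+1 k).
  elim: s => [|s IH] k; last exact: picard_eqcoef.
  by move=> [|//] _; rewrite !It0.
exists (It N.+1) => k.
have eqW : eqcoef N (It N.+1 k)^`() (comp_field (It N.+1) k).
  move=> i iN; rewrite coef_deriv_picard iN.
  rewrite (@comp_field_eqcoef N.+1 _ (It N.+1)) //; last exact: ltnW.
split=> //; first exact: size_poly.
rewrite (le_trans (ler_wnormD _ _ w0')) // wnormN mulr_natl mulr2n.
rewrite lerD ?WM //; apply: le_trans (WM _ (Itr N) k).
apply: ler_wnorm => // i; rewrite coef_deriv_picard.
by case: ifP => _; rewrite ?normr0.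
Qed.

Lemma horner_comp_field P k t :
  (comp_field P k).[t] = \sum_(a <- J) monomial a (\row_i (P i).[t]) * c a k.
Proof.
rewrite horner_sum; apply: eq_bigr => a _; rewrite hornerZ mulrC horner_prod.
by congr (_ * _); apply: eq_bigr => i _; rewrite horner_exp mxE.
Qed.

End PolySolution.

(** * Unconditional convergence in finite dimension *)

#[local] Existing Instance summability.totally_filter.

Lemma partial_sumE (I : choiceType) (V : zmodType) (u : I -> V) (J : {fset I}) :
  summability.partial_sum u J = \sum_(a <- J) u a.
Proof. by rewrite big_seq_fsetE. Qed.

Section SupNorm.
Context {R : realType} {n : nat}.
Implicit Types v : 'rV[R]_n.

Lemma rV_norm_le v e : 0 <= e -> (forall k, `|v 0 k| <= e) -> `|v| <= e.
Proof.
move=> e0 ve; rewrite [leLHS]/Num.Def.normr/= mx_normrE (bigmax_le _ e0)//.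
by move=> -[i k] _ /=; rewrite ord1.
Qed.

Lemma rV_coord_le v k : `|v 0 k| <= `|v|.
Proof.
rewrite [leRHS]/Num.Def.normr/= mx_normrE.
exact: (le_bigmax 0 (fun ij => `|v ij.1 ij.2|) (0, k)).
Qed.

Lemma rV_norm_le_sum v : `|v| <= \sum_k `|v 0 k|.
Proof.
apply: rV_norm_le => [|k]; first exact: sumr_ge0.
by rewrite (bigD1 k) //= lerDl sumr_ge0.
Qed.

End SupNorm.

Section Unconditional.
Context {R : realType} {I : choiceType}.
Lemma cvg_dist_le {T : Type} {V : normedModType R} (F : set_system T)
    {FF : ProperFilter F} (f : T -> V) (l v : V) (b : R) :
  (f @ F --> l)%classic -> (\forall x \near F, `|f x - v| <= b) ->
  `|l - v| <= b.
Proof.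
move=> fl fb; apply/ler_addgt0Pr => e e0.
have /cvgrPdist_le/(_ _ e0) le := fl.
have [x [lx xb]] := filter_ex (filterI le fb).
rewrite [b + e]addrC -(subrK (f x) l) -addrA.
by rewrite (le_trans (ler_normD _ _)) ?lerD.
Qed.

(** The Cauchy property bounds the sums over finite sets containing some fixed
    [J0]; any other sum differs from one of these by a sum over part of [J0]. *)
Lemma net_bounded_sums (u : I -> R) (l : R) :
  (summability.partial_sum u @ summability.totally --> l)%classic ->
  exists M, forall J : {fset I}, `|\sum_(a <- J) u a| <= M.
Proof.
move=> /cvgrPdist_le/(_ _ ltr01)[J0 _ hJ0].
exists (`|l| + 1 + \sum_(a <- J0) `|u a|) => J.
have -> : \sum_(a <- J) u a =
    \sum_(a <- (J `|` J0)%fset) u a - \sum_(a <- J0 | a \notin J) u a.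
  rewrite (big_fsetID _ (mem J) (J `|` J0)%fset) /=.
  apply/eqP; rewrite -subr_eq opprK.
  apply/eqP; congr (_ + _).
    by apply: eq_fbigl => a; rewrite !inE; case: (a \in J); rewrite ?andbF.
  rewrite big_fset_condE; apply: eq_fbigl => a; rewrite !inE.
  by case: (a \in J); rewrite ?andbF.
rewrite (le_trans (ler_normB _ _)) // lerD //.
  have := hJ0 (J `|` J0)%fset (fsubsetUr _ _).
  rewrite /= partial_sumE => h.
  by have := ler_distD l 0 (\sum_(a <- (J `|` J0)%fset) u a);
    rewrite !sub0r !normrN => h'; lra.
rewrite (le_trans (ler_norm_sum _ _ _)) //.
rewrite [leRHS](bigID (fun a => a \notin J)) /=.
by rewrite lerDl sumr_ge0.
Qed.

(** The terms of each sign are summed separately. *)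
Lemma net_bounded_abs_sums (u : I -> R) (l : R) :
  (summability.partial_sum u @ summability.totally --> l)%classic ->
  exists M, forall J : {fset I}, \sum_(a <- J) `|u a| <= M.
Proof.
move=> /net_bounded_sums[M hM]; exists (M + M) => J.
rewrite (big_fsetID _ (fun a => 0 <= u a)) /= lerD //.
  apply: le_trans (hM [fset a in J | 0 <= u a]%fset); rewrite -!big_fset_condE.
  rewrite (eq_bigr u); last by move=> a; exact: ger0_norm.
  exact: ler_norm.
apply: le_trans (hM [fset a in J | ~~ (0 <= u a)]%fset); rewrite -!big_fset_condE.
rewrite (eq_bigr (fun a => - u a)).
  by rewrite -normrN -sumrN ler_norm.
by move=> a; rewrite -ltNge; exact: ltr0_norm.
Qed.

End Unconditional.

(** * Estimates for power series in several variables *)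

Section PowerSeries.
Context {R : realType} {n : nat}.
Implicit Types (a : {ffun 'I_n -> nat}) (y z : 'rV[R]_n).

Definition mdeg a := (\sum_i a i)%N.

Lemma ler_monomial a y s : `|y| <= s -> `|monomial a y| <= s ^+ mdeg a.
Proof.
move=> ys; have s0 := le_trans (normr_ge0 y) ys.
rewrite /monomial normr_prod -prodrXr ler_prod // => i _.
rewrite normr_ge0 normrX lerXn2r ?nnegrE //.
exact: le_trans (rV_coord_le _ _) ys.
Qed.

(** Multiplying by [s] avoids the exponent [mdeg a - 1] of the mean value bound.
    The estimate is proved factor by factor, as a property [K] of pairs of
    numbers that is stable under products. *)
Lemma monomial_lipschitz a y z s : `|y| <= s -> `|z| <= s ->
  s * `|monomial a y - monomial a z| <= (mdeg a)%:R * s ^+ mdeg a * `|y - z|.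
Proof.
move=> ys zs; have s0 := le_trans (normr_ge0 y) ys; set d := `|y - z|.
have d0 : 0 <= d by exact: normr_ge0.
pose K (m : nat) (u v : R) := [/\ `|u| <= s ^+ m, `|v| <= s ^+ m &
  s * `|u - v| <= m%:R * s ^+ m * d].
have K1 : K 0 1 1 by rewrite /K !expr0 normr1 subrr normr0 mulr0 !mul0r.
have KM m m' u u' v v' : K m u v -> K m' u' v' -> K (m + m')%N (u * u') (v * v').
  move=> [um vm uv] [um' vm' uv']; rewrite /K !normrM exprD.
  split; [by rewrite ler_pM|by rewrite ler_pM|].
  rewrite (_ : u * u' - v * v' = (u - v) * u' + v * (u' - v')); last by ring.
  apply: (@le_trans _ _ (s * `|u - v| * `|u'| + `|v| * (s * `|u' - v'|))).
    rewrite -mulrA [X in _ <= _ + X]mulrCA -mulrDr ler_wpM2l // -!normrM.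
    exact: ler_normD.
  have h1 : s * `|u - v| * `|u'| <= m%:R * s ^+ m * d * s ^+ m'.
    by rewrite ler_pM // mulr_ge0.
  have h2 : `|v| * (s * `|u' - v'|) <= s ^+ m * (m'%:R * s ^+ m' * d).
    by rewrite ler_pM // mulr_ge0.
  apply: le_trans (lerD h1 h2) _.
  by rewrite natrD le_eqVlt; apply/orP; left; apply/eqP; ring.
have KX i m : K m (y 0 i ^+ m) (z 0 i ^+ m).
  elim: m => [|m IH]; first by rewrite !expr0.
  rewrite !exprS -add1n; apply: KM => //.
  split; rewrite ?expr1 ?mul1r; try exact: le_trans (rV_coord_le _ _) _.
  rewrite ler_wpM2l //; have := rV_coord_le (y - z) i; by rewrite !mxE.
suff [] : K (mdeg a) (monomial a y) (monomial a z) by [].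
rewrite /mdeg /monomial; elim/big_ind3: _ => // *; exact: KM.
Qed.

(** The exponents whose entries are all at most [N] form such a set. *)
Lemma exists_low_degree_fset N :
  exists J : {fset {ffun 'I_n -> nat}}, forall a, (mdeg a <= N)%N -> a \in J.
Proof.
pose h (b : {ffun 'I_n -> 'I_N.+1}) : {ffun 'I_n -> nat} := [ffun i => val (b i)].
exists [fset h b | b : {ffun 'I_n -> 'I_N.+1}]%fset => a aN.
apply/imfsetP; exists [ffun i => inord (a i)] => //=.
apply/ffunP => i; rewrite !ffunE /= inordK // ltnS (leq_trans _ aN) //.
by rewrite /mdeg (bigD1 i) //= leq_addr.
Qed.

(** A function that is near [p] the unconditional sum of a power series whose
    absolute sums at radius [r] are bounded by [M]. *)
Section At.
Context {m : nat} (g : 'rV[R]_n -> 'rV[R]_m) (p : 'rV[R]_n).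
Variables (c : {ffun 'I_n -> nat} -> 'rV[R]_m) (r M : R).
Hypotheses (r0 : 0 < r)
  (cM : forall J : {fset {ffun 'I_n -> nat}},
    \sum_(a <- J) `|c a| * r ^+ mdeg a <= M)
  (cg : forall y, `|y - p| <= r ->
    summability.partial_sum (fun a => monomial a (y - p) *: c a)
      @ summability.totally --> g y).

(** Outside [J] only degrees above [N] occur, and each of them gains at least the
    factor [th ^ N] over its value at radius [r]. *)
Lemma taylor_remainder N (J : {fset {ffun 'I_n -> nat}}) y (th : R) :
  (forall a, (mdeg a <= N)%N -> a \in J) -> 0 <= th <= 1 ->
  `|y - p| <= r * th ->
  `|g y - \sum_(a <- J) monomial a (y - p) *: c a| <= M * th ^+ N.
Proof.
move=> hJ /andP[th0 th1] yth.
have yr : `|y - p| <= r by apply: le_trans yth _; rewrite ger_pMr.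
apply: cvg_dist_le (cg yr) _; exists J => //= J' JJ'.
rewrite partial_sumE.
rewrite (big_fsetID _ (mem J) J') /=.
have -> : [fset x in J' | x \in J]%fset = J.
  apply/fsetP => a; rewrite !inE /= andbC.
  by case: (boolP (a \in J)) => // /(fsubsetP JJ').
rewrite addrAC subrr add0r (le_trans (ler_norm_sum _ _ _)) //.
apply: le_trans (ler_wpM2r (exprn_ge0 N th0) (cM _)).
rewrite mulr_suml big_seq [leRHS]big_seq; apply: ler_sum => a.
rewrite !inE /= => /andP[_ aJ]; rewrite normrZ mulrC -mulrA ler_wpM2l //.
apply: le_trans (ler_monomial _ yth) _; rewrite exprMn ler_wpM2l ?exprn_ge0 //.
  exact: ltW.
apply: ler_wiXn2l => //; rewrite leqNgt; apply: contra aJ => aN.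
by apply: hJ; exact: ltnW.
Qed.

(** Halving the radius absorbs the factor [mdeg a] of [monomial_lipschitz],
    since [m <= 2 ^ m]. *)
Lemma power_series_lipschitz y z : `|y - p| <= r / 2 -> `|z - p| <= r / 2 ->
  `|g y - g z| <= 2 * M / r * `|y - z|.
Proof.
move=> yr zr; have hr : r / 2 <= r by have := r0; lra.
rewrite -[g y - _]subr0.
pose psum x := summability.partial_sum (fun a => monomial a (x - p) *: c a).
have cgB : (fun J => psum y J - psum z J) @ summability.totally --> g y - g z.
  by apply: cvgB; apply: cg; exact: le_trans hr.
apply: cvg_dist_le cgB _; apply: nearW => J /=.
rewrite subr0 /psum !partial_sumE -sumrB.
rewrite (le_trans (ler_norm_sum _ _ _)) //.
apply: le_trans
  (_ : 2 / r * `|y - z| * \sum_(a <- J) `|c a| * r ^+ mdeg a <= _); last first.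
  rewrite (_ : 2 * M / r * _ = 2 / r * `|y - z| * M); last by ring.
  by rewrite ler_wpM2l // mulr_ge0 // divr_ge0 // ltW.
rewrite mulr_sumr; apply: ler_sum => a _; rewrite -scalerBl normrZ mulrC.
rewrite [leRHS]mulrCA ler_wpM2l //.
have := monomial_lipschitz a yr zr.
rewrite opprB addrA subrK => h.
have h2 : (mdeg a)%:R * (r / 2) ^+ mdeg a <= r ^+ mdeg a.
  rewrite exprMn mulrCA ger_pMr ?exprn_gt0 // exprVn ler_pdivrMr ?exprn_gt0 //.
  by rewrite mul1r -natrX ler_nat ltnW // ltn_expl.
rewrite -(ler_pM2l (_ : 0 < r / 2)); last by rewrite divr_gt0.
apply: le_trans h _; rewrite (_ : r / 2 * _ = r ^+ mdeg a * `|y - z|).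
  by rewrite ler_wpM2r.
by field; rewrite lt0r_neq0.
Qed.

End At.

(** At the corner [p + (r, ..., r)] of a cube, monomials equal [r ^ mdeg a], so
    convergence at this single point bounds the absolute sums at radius [r]. *)
Lemma analytic_at_coeffs m (g : 'rV[R]_n -> 'rV[R]_m) p : analytic_at g p ->
  exists (c : {ffun 'I_n -> nat} -> 'rV[R]_m) (r M : R), [/\ 0 < r,
    forall J : {fset {ffun 'I_n -> nat}},
      \sum_(a <- J) `|c a| * r ^+ mdeg a <= M &
    forall y, `|y - p| <= r ->
      summability.partial_sum (fun a => monomial a (y - p) *: c a)
        @ summability.totally --> g y].
Proof.
move=> [c /nbhs_normP[e /= e0 hc]].
have r0 : 0 < e / 2 by rewrite divr_gt0.
have cg y : `|y - p| <= e / 2 ->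
    summability.partial_sum (fun a => monomial a (y - p) *: c a)
      @ summability.totally --> g y.
  by move=> yr; apply: hc; rewrite /= distrC (le_lt_trans yr) //; lra.
have /cg cq : `|p + const_mx (e / 2) - p| <= e / 2.
  rewrite addrC addKr; apply: rV_norm_le => [|k]; first exact: ltW.
  by rewrite mxE gtr0_norm.
have hM k : exists Mk, forall J : {fset {ffun 'I_n -> nat}},
    \sum_(a <- J) `|c a 0 k| * (e / 2) ^+ mdeg a <= Mk.
  have ck : summability.partial_sum (fun a => (e / 2) ^+ mdeg a * c a 0 k)
      @ summability.totally --> g (p + const_mx (e / 2)) 0 k.
    have := cvg_comp _ _ cq (@coord_continuous _ _ _ 0 k _).
    apply: cvg_trans; apply: near_eq_cvg; apply: nearW => J /=.
    rewrite !partial_sumE summxE; apply: eq_bigr => a _.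
    rewrite !mxE; congr (_ * _); rewrite /monomial -prodrXr.
    by apply: eq_bigr => i _; rewrite !mxE addrC addKr.
  have [Mk hMk] := net_bounded_abs_sums ck; exists Mk => J.
  apply: le_trans (hMk J); apply: ler_sum => a _.
  by rewrite normrM mulrC ger0_norm // exprn_ge0 // ltW.
have [Mk hMk] := choice hM.
exists c, (e / 2), (\sum_k Mk k); split => // J.
apply: le_trans (ler_sum _ (fun k _ => hMk k J)); rewrite exchange_big /=.
apply: ler_sum => a _; rewrite -mulr_suml ler_wpM2r ?exprn_ge0 ?(ltW r0) //.
exact: rV_norm_le_sum.
Qed.

End PowerSeries.

(** * Approximate solutions of analytic systems *)

Section Solvable.
Context {R : realType} {n : nat}.
Implicit Types (P Q : 'I_n -> {poly R}) (g : 'rV[R]_n -> 'rV[R]_n).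
Implicit Types (p : 'rV[R]_n) (C t : R).

Definition poly_curve P t : 'rV[R]_n := \row_k (P k).[t].

(** The field [g] is Lipschitz near [p], and the initial value problem
    [y' = g y], [y 0 = p] has polynomial solutions up to every order [N]. A
    single constant [C], the same for all [N], serves as Lipschitz constant,
    speed, growth rate of the defect and inverse of the radii: the whole
    property is then monotone in [C] ([approx_solvable_le]), so finitely many
    fields can share one constant. *)
Definition approx_solvable C g p :=
  [/\ 1 <= C,
    forall y z, C * `|y - p| <= 1 -> C * `|z - p| <= 1 ->
      `|g y - g z| <= C * `|y - z| &
    forall N, exists P, (forall k, (size (P k) <= N.+1)%N) /\
      forall t, 0 <= t -> C * (C * t) <= 1 ->
        `|poly_curve P t - p| <= C * t /\
        `|poly_curve (fun k => (P k)^`()) t - g (poly_curve P t)|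
          <= C * (C * t) ^+ N].

Lemma approx_solvable_le C C' g p : C <= C' ->
  approx_solvable C g p -> approx_solvable C' g p.
Proof.
move=> CC [C1 lip sol]; have C0 := le_trans ler01 C1.
have C'0 := le_trans C0 CC.
split; first exact: le_trans CC.
  move=> y z yp zp; apply: le_trans (lip _ _ _ _) _; last exact: ler_wpM2r.
    by apply: le_trans yp; exact: ler_wpM2r.
  by apply: le_trans zp; exact: ler_wpM2r.
move=> N; have [P [sP hP]] := sol N; exists P; split => // t t0 Ct.
have CCt : C * t <= C' * t by exact: ler_wpM2r.
have Ct0 : 0 <= C * t by exact: mulr_ge0.
have [|h1 h2] := hP t t0; first by apply: le_trans Ct; exact: ler_pM.
split; first exact: le_trans CCt.
apply: le_trans h2 _; apply: ler_pM; rewrite ?exprn_ge0 //.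
by rewrite lerXn2r // nnegrE (le_trans Ct0).
Qed.

(** The polynomials of [poly_solution] solve the system given by a partial sum
    of the power series of [g] containing all degrees up to [N]. What remains is
    the part of their defect of order [N], which their norm controls, and the
    Taylor remainder of [g]. *)
Lemma analytic_approx_solvable g p : analytic_at g p ->
  exists C, approx_solvable C g p.
Proof.
move=> /analytic_at_coeffs[c [r [M [r0 cM cg]]]].
have M0 : 0 <= M.
  apply: (le_trans _ (cM fset0)); apply: sumr_ge0 => a _.
  by rewrite mulr_ge0 // exprn_ge0 // ltW.
pose w := r / (M + 1); have w0 : 0 < w by rewrite divr_gt0 // ltr_wpDl.
have wM : w * M <= r.
  rewrite /w mulrAC ler_pdivrMr ?ltr_wpDl // ler_pM2l //; lra.
(* In order: for [1 <= C], the Lipschitz constant on the ball of radius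
   [r / 2], the inverse of that radius, the speed, the defect, and the inverse
   of the time radius [w]. *)
pose C := 1 + 2 * M / r + 2 / r + r / w + 3 * M + 1 / w.
have e1 : 0 <= 2 * M / r by rewrite divr_ge0 ?mulr_ge0 // ltW.
have e2 : 0 <= 2 / r by rewrite divr_ge0 // ltW.
have e3 : 0 <= r / w by rewrite divr_ge0 // ltW.
have e4 : 0 <= 3 * M by rewrite mulr_ge0.
have e5 : 0 <= 1 / w by rewrite divr_ge0 // ltW.
have C1 : 1 <= C by rewrite /C; lra.
have C0 : 0 <= C by exact: le_trans C1.
exists C; split => // [y z yp zp|N].
  have near_r v : C * `|v - p| <= 1 -> `|v - p| <= r / 2.
    move=> Cv; rewrite -(ler_pM2l (_ : 0 < 2 / r)) ?divr_gt0 //.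
    rewrite (_ : 2 / r * (r / 2) = 1); last by field; rewrite lt0r_neq0.
    apply: le_trans Cv; apply: ler_wpM2r => //; rewrite /C; lra.
  apply: le_trans (power_series_lipschitz r0 cM cg (near_r _ yp) (near_r _ zp)) _.
  by apply: ler_wpM2r => //; rewrite /C; lra.
have [J hJ] := @exists_low_degree_fset n N.
have cMk k : \sum_(a <- J) `|c a 0 k| * r ^+ (\sum_i a i) <= M.
  apply: le_trans (cM J); apply: ler_sum => a _.
  by rewrite ler_wpM2r ?exprn_ge0 ?(ltW r0) // rV_coord_le.
have [P hP] := poly_solution N w0 (ltW r0) wM cMk.
exists (fun k => P k + (p 0 k)%:P); split.
  move=> k; rewrite (leq_trans (size_polyD _ _)) // geq_max.
  by have [-> _ _ _ _] := hP k; rewrite (leq_trans (size_polyC_leq1 _)).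
move=> t t0 Ct.
have Ct1 : C * t <= 1.
  by apply: le_trans Ct; rewrite ler_peMl // mulr_ge0.
have twC : t / w <= C * t.
  by rewrite mulrC ler_wpM2r //; rewrite -div1r /C; lra.
have tw0 : 0 <= t / w by rewrite divr_ge0 // ltW.
have tw1 : t / w <= 1 by exact: le_trans Ct1.
have tw : t <= w by move: tw1; rewrite ler_pdivrMr // mul1r.
have curveE : poly_curve (fun k => P k + (p 0 k)%:P) t = p + poly_curve P t.
  by apply/rowP => k; rewrite !mxE hornerD hornerC addrC.
have small : `|poly_curve P t| <= r * (t / w).
  apply: rV_norm_le => [|k]; first by rewrite mulr_ge0 // ltW.
  have [_ Pk0 Pkr _ _] := hP k; rewrite mxE.
  have /= := @ler_horner_wnorm _ w (P k) 1 t w0.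
  rewrite t0 tw expr1 => /(_ isT) h.
  apply: le_trans (h _) _; first by case.
  by rewrite ler_wpM2r.
rewrite curveE; split.
  rewrite addrAC subrr add0r; apply: le_trans small _.
  by rewrite mulrCA mulrC ler_wpM2r // /C; lra.
set q := \sum_(a <- J) monomial a (poly_curve P t) *: c a.
have qE k : q 0 k = (comp_field J (fun a k => c a 0 k) P k).[t].
  by rewrite horner_comp_field /q summxE; apply: eq_bigr => a _; rewrite mxE.
have h1 : `|poly_curve (fun k => (P k + (p 0 k)%:P)^`()) t - q|
    <= 2 * M * (t / w) ^+ N.
  apply: rV_norm_le => [|k].
    by apply: mulr_ge0; [exact: mulr_ge0|exact: exprn_ge0].
  have [_ _ _ PkM Pkeq] := hP k.
  rewrite mxE [X in X + _]mxE [X in _ + X]mxE qE derivD derivC addr0.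
  rewrite -hornerN -hornerD.
  apply: le_trans (ler_horner_wnorm (N := N) w0 _ _) _.
  - by rewrite t0.
  - by move=> i iN; rewrite coefB Pkeq // subrr.
  - by rewrite ler_wpM2r // exprn_ge0.
have h2 : `|q - g (p + poly_curve P t)| <= M * (t / w) ^+ N.
  have := taylor_remainder (y := p + poly_curve P t) (th := t / w) r0 cM cg hJ.
  have -> : p + poly_curve P t - p = poly_curve P t by rewrite addrAC subrr add0r.
  by move=> h; rewrite distrC h // tw0.
rewrite -(subrKA q) (le_trans (ler_normD _ _)) // (le_trans (lerD h1 h2)) //.
rewrite -mulrDl; apply: ler_pM; rewrite ?exprn_ge0 //; first lra.
  by rewrite /C; lra.
by rewrite lerXn2r // nnegrE mulr_ge0.
Qed.

End Solvable.

(** * A short-time Gronwall inequality *)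

Section Gronwall.
Context {R : realType} {n : nat}.

Lemma is_derive_coord (z : R -> 'rV[R]_n) (t : R) dz k :
  is_derive t 1 z dz -> is_derive t 1 (fun s => z s 0 k) (dz 0 k).
Proof.
move=> [zt <-]; have zkt := (derivable_mxP z t 1).1 zt.
by apply: DeriveDef => //; rewrite derive_mx // mxE.
Qed.

Lemma is_derive_poly_curve (P : 'I_n -> {poly R}) (t : R) :
  is_derive t 1 (poly_curve P) (poly_curve (fun k => (P k)^`()) t).
Proof.
have coordE k : (fun s => poly_curve P s 0 k) = horner (P k).
  by apply/funext => s; rewrite mxE.
have D : derivable (poly_curve P) t 1.
  apply/derivable_mxP => i j; rewrite ord1 coordE; exact: derivable_horner.
apply: DeriveDef => //; apply/rowP => k; rewrite derive_mx // !mxE coordE.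
exact: derive_val.
Qed.

(** On so short an interval no exponential is needed. Let [c] maximize [`|z|] on
    [[0, t]]; the mean value theorem on [[0, c]], applied to each coordinate,
    gives [`|z c| <= t * (L * `|z c| + phi t)], and [L * t <= 1 / 2] allows the
    term [`|z c|] on the right to be absorbed. *)
Lemma short_time_gronwall (z z' : R -> 'rV[R]_n) (phi : R -> R) (L d : R) :
  0 <= L -> L * d <= 1 / 2 -> z 0 = 0 ->
  (forall t, 0 <= t <= d -> is_derive t 1 z (z' t)) ->
  (forall t, 0 < t <= d -> `|z' t| <= L * `|z t| + phi t) ->
  (forall t, 0 <= t <= d -> 0 <= phi t) ->
  (forall s t, 0 <= s -> s <= t <= d -> phi s <= phi t) ->
  forall t, 0 <= t <= d -> `|z t| <= 2 * t * phi t.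
Proof.
move=> L0 Ld z0 zd zb phi0 phim t /andP[t0 td].
have zc s : 0 <= s <= d -> {for s, continuous z}.
  by move=> /zd [zs _]; apply: differentiable_continuous; exact/derivable1_diffP.
have zwc : {within `[0, t], continuous (fun s => `|z s|)}.
  apply: continuous_in_subspaceT => s; rewrite inE /= in_itv /= => /andP[s0 st].
  apply: continuous_comp; last exact: norm_continuous.
  by apply: zc; rewrite s0 (le_trans st).
have [c] := EVT_max t0 zwc; rewrite in_itv /= => /andP[c0 ct] cmax.
have zt : `|z t| <= `|z c| by apply: cmax; rewrite in_itv /= t0 lexx.
have phit : 0 <= phi t by apply: phi0; rewrite t0.
have [c00|c00] := eqVneq c 0.
  by move: zt; rewrite c00 z0 normr0 => /le_trans -> //; rewrite !mulr_ge0.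
have cpos : 0 < c by rewrite lt_def c00.
have : `|z c| <= t * (L * `|z c| + phi t).
  apply: rV_norm_le => [|k]; first by rewrite mulr_ge0 // addr_ge0 // mulr_ge0.
  have [||s] := @MVT R (fun s => z s 0 k) (fun s => z' s 0 k) 0 c cpos.
  - move=> s; rewrite in_itv /= => /andP[s0 sc]; apply: is_derive_coord.
    by apply: zd; rewrite (ltW s0) (le_trans (ltW sc)) // (le_trans ct).
  - apply: continuous_in_subspaceT => s; rewrite inE /= in_itv /= => /andP[s0 sc].
    apply: (continuous_comp (g := fun v : 'rV[R]_n => v 0 k)).
      by apply: zc; rewrite s0 (le_trans sc) // (le_trans ct).
    exact: coord_continuous.
  rewrite in_itv /= => /andP[s0 sc]; rewrite z0 mxE !subr0 => ->.
  have st : s <= t by rewrite (le_trans (ltW sc)).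
  have sd : s <= d by exact: le_trans td.
  rewrite normrM (gtr0_norm cpos) mulrC ler_pM //.
  apply: le_trans (rV_coord_le _ _) _; apply: le_trans (zb s _) _; first by rewrite s0.
  rewrite lerD //; last by apply: phim; rewrite ?(ltW s0) // st.
  by rewrite ler_wpM2l // cmax // in_itv /= (ltW s0).
have : L * t * `|z c| <= 1 / 2 * `|z c|.
  by rewrite ler_wpM2r // (le_trans _ Ld) // ler_wpM2l.
move: zt phit; nra.
Qed.

End Gronwall.

(** * Behaviour at small positive times *)

Section SmallTimes.
Context {R : realType}.
Implicit Types (q : {poly R}) (P Q : R -> Prop).

(** The dual of [\forall t \near 0^'+], in a form suited to picking times. *)
Definition frequently P := forall e : R, 0 < e -> exists t, 0 < t < e /\ P t.

Lemma near0rP P :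
  (\forall t \near 0^'+, P t) <->
  exists2 e : R, 0 < e & forall t, 0 < t < e -> P t.
Proof.
split=> [/nbhs_ballP[e /= e0 eP]|[e e0 eP]].
  exists e => // t /andP[t0 te]; apply: eP => //=.
  by rewrite /ball /= sub0r normrN gtr0_norm.
near=> t; apply: eP; apply/andP; split; near: t.
  exact: nbhs_right_gt.
exact: nbhs_right_lt.
Unshelve. all: by end_near. Qed.

Lemma not_frequently P : ~ frequently P -> \forall t \near 0^'+, ~ P t.
Proof.
move=> nP; apply/near0rP; apply: contrapT => nE; apply: nP => e e0.
apply: contrapT => nt; apply: nE; exists e => // t te Pt.
by apply: nt; exists t.
Qed.

Lemma frequently_near P Q : frequently P -> (\forall t \near 0^'+, Q t) ->
  frequently (fun t => P t /\ Q t).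
Proof.
move=> fP /near0rP[e e0 eQ] e' e'0.
have [|t [/andP[t0 te] Pt]] := fP (Num.min e e'); first by rewrite lt_min e0.
move: te; rewrite lt_min => /andP[te te'].
by exists t; split; [rewrite t0|split=> //; apply: eQ; rewrite t0].
Qed.

Lemma poly_lowest_term q k t : (forall i, (i < k)%N -> q`_i = 0) ->
  0 <= t <= 1 -> `|q.[t] - q`_k * t ^+ k| <= wnorm 1 q * t ^+ k.+1.
Proof.
move=> qk t01.
have := @ler_horner_wnorm R 1 (q - q`_k *: 'X^k) k.+1 t ltr01 t01.
rewrite hornerD hornerN hornerZ hornerXn divr1 => h; apply: le_trans (h _) _.
  move=> i; rewrite ltnS coefB coefZ coefXn leq_eqVlt => /orP[/eqP ->|ik].
    by rewrite eqxx mulr1 subrr.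
    by rewrite (qk i ik) (ltn_eqF ik) mulr0 subr0.
have t0 : 0 <= t by case/andP: t01.
apply: ler_wpM2r; first exact: exprn_ge0.
apply: ler_wnorm => // i; rewrite coefB coefZ coefXn.
by case: eqP => [->|_]; rewrite ?mulr1 ?subrr ?normr0 // mulr0 subr0.
Qed.

Lemma exists_lowest_term q : q != 0 -> exists k,
  [/\ (k < size q)%N, q`_k != 0 & forall i, (i < k)%N -> q`_i = 0].
Proof.
move=> q0; have ex : exists k, q`_k != 0.
  by exists (size q).-1; rewrite -lead_coefE lead_coef_eq0.
case: (ex_minnP ex) => k qk kmin; exists k; split=> //.
  by rewrite ltnNge; apply: contra qk => sk; rewrite nth_default.
by move=> i; apply: contraTeq => /kmin; rewrite -leqNgt.
Qed.

(** The lowest term of a nonzero [q] has degree below [m] and would dominate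
    [K * t ^ m]. *)
Lemma poly_frequently_small q m (K : R) : 0 <= K -> (size q <= m)%N ->
  frequently (fun t => `|q.[t]| <= K * t ^+ m) -> q = 0.
Proof.
move=> K0 qm fq; apply/eqP; apply: contrapT.
move=> /negP/exists_lowest_term[k [kq qk qlow]].
have W0 : 0 <= wnorm 1 q by exact: wnorm_ge0.
set W := wnorm 1 q in W0.
have a0 : 0 < `|q`_k| by rewrite normr_gt0.
have E0 : 0 < K + W + 1 by rewrite ltr_wpDl // addr_ge0.
have [|t [/andP[t0 te] qt]] := fq (Num.min 1 (`|q`_k| / (K + W + 1))).
  by rewrite lt_min ltr01 divr_gt0.
move: te; rewrite lt_min => /andP[t1]; rewrite ltr_pdivlMr // => tE.
have t01 : 0 <= t <= 1 by rewrite !ltW.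
have h := poly_lowest_term qlow t01; rewrite -/W in h.
have tk0 : 0 < t ^+ k by rewrite exprn_gt0.
have tm : t ^+ m <= t ^+ k.+1.
  by apply: ler_wiXn2l; rewrite ?ltW // (leq_trans kq).
have : `|q`_k| * t ^+ k <= (K + W) * t * t ^+ k.
  rewrite -[t ^+ k in leLHS]gtr0_norm // -normrM.
  rewrite -[q`_k * _](subKr q.[t]) (le_trans (ler_normB _ _)) //.
  rewrite -mulrA -exprS mulrDl lerD //.
  by apply: le_trans qt _; rewrite ler_wpM2l.
rewrite ler_pM2r //; lra.
Qed.

(** Analytic functions of one variable have this property; here analyticity is
    replaced by approximations [F N] whose errors grow at most geometrically
    with [N], with no reference to a limiting power series. If all [F N] vanish,
    so does [f] where [B * t <= 1 / 2], on letting [N] tend to infinity.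
    Otherwise the lowest term of some nonzero [F N] has degree at most [N], and
    dominates the error. *)
Lemma eventually_constant_sign (f : R -> R) (F : nat -> {poly R}) (K B d : R) :
  0 < d -> 0 <= K -> 0 <= B -> (forall N, (size (F N) <= N.+1)%N) ->
  (forall N t, 0 <= t <= d -> `|f t - (F N).[t]| <= K * (B * t) ^+ N.+1) ->
  (\forall t \near 0^'+, 0 <= f t) \/ (\forall t \near 0^'+, f t < 0).
Proof.
move=> d0 K0 B0 sF hF.
have [F0|] := pselect (forall N, F N = 0).
  left; apply/near0rP; exists (Num.min d (1 / (2 * (B + 1)))).
    by rewrite lt_min d0 divr_gt0 // mulr_gt0 // ltr_wpDl.
  move=> t; rewrite lt_min => /and3P[t0 td].
  rewrite ltr_pdivlMr ?mulr_gt0 ?ltr_wpDl // => tB.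
  have Bt : B * t <= 1 / 2 by lra.
  have Bt0 : 0 <= B * t by rewrite mulr_ge0 // ltW.
  have [->//|ft0] := eqVneq (f t) 0; exfalso.
  have ft : 0 < `|f t| by rewrite normr_gt0.
  have KfP : 0 <= K / `|f t| by rewrite divr_ge0.
  have := archi_boundP KfP; set N := Num.bound _; rewrite ltr_pdivrMr // => KN.
  have h : `|f t| <= K * (B * t) ^+ N.+1.
    by have := hF N t; rewrite F0 horner0 subr0; apply; rewrite !ltW.
  have h2 : K * (B * t) ^+ N.+1 <= K * (1 / 2) ^+ N.
    rewrite ler_wpM2l // exprS.
    apply: (@le_trans _ _ (1 * (B * t) ^+ N)).
      by rewrite ler_wpM2r ?exprn_ge0 //; lra.
    by rewrite mul1r lerXn2r // nnegrE divr_ge0.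
  have : `|f t| * 2 ^+ N <= K.
    apply: (@le_trans _ _ (K * (1 / 2) ^+ N * 2 ^+ N)).
      by rewrite ler_wpM2r ?exprn_ge0 // (le_trans h).
    by rewrite -mulrA -exprMn divfK ?pnatr_eq0 // expr1n mulr1.
  apply/negP; rewrite -ltNge (lt_le_trans KN) // mulrC ler_wpM2l //.
  by rewrite -natrX ler_nat ltnW // ltn_expl.
move=> /existsNP[N /eqP/exists_lowest_term[k [kN qk qlow]]].
set W := wnorm 1 (F N); set a := (F N)`_k in qk.
have W0 : 0 <= W by exact: wnorm_ge0.
pose E := K * B ^+ N.+1 + W.
have E0 : 0 <= E by rewrite addr_ge0 // mulr_ge0 // exprn_ge0.
have a0 : 0 < `|a| by rewrite normr_gt0.
pose e := Num.min d (Num.min 1 (`|a| / (E + 1))).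
have e0 : 0 < e by rewrite !lt_min d0 ltr01 divr_gt0 // ltr_wpDl.
have dom t : 0 < t < e -> `|f t - a * t ^+ k| < `|a| * t ^+ k.
  move=> /andP[t0]; rewrite !lt_min => /and3P[td t1].
  rewrite ltr_pdivlMr ?ltr_wpDl // => tE.
  have t01 : 0 <= t <= 1 by rewrite !ltW.
  have tk0 : 0 < t ^+ k by rewrite exprn_gt0.
  apply: (@le_lt_trans _ _ (E * t * t ^+ k)); last first.
    by rewrite ltr_pM2r //; lra.
  rewrite -mulrA -exprS /E mulrDl -(subrKA (F N).[t]).
  rewrite (le_trans (ler_normD _ _)) // lerD //; last exact: poly_lowest_term.
  apply: le_trans (hF N t _) _; first by rewrite !ltW.
  rewrite exprMn mulrA ler_wpM2l ?mulr_ge0 ?exprn_ge0 //.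
  by apply: ler_wiXn2l; rewrite ?ltW // (leq_trans kN).
have [ap|an] : 0 < a \/ a < 0 by move: qk; rewrite neq_lt => /orP[]; [right|left].
  left; apply/near0rP; exists e => // t te; have := dom t te.
  have tk0 : 0 < t ^+ k by rewrite exprn_gt0 //; case/andP: te.
  by rewrite (gtr0_norm ap) ltr_norml => /andP[h _]; lra.
right; apply/near0rP; exists e => // t te; have := dom t te.
have tk0 : 0 < t ^+ k by rewrite exprn_gt0 //; case/andP: te.
by rewrite (ltr0_norm an) ltr_norml => /andP[_ h]; lra.
Qed.

(** If [phi] took two values on the pieces that [x] keeps meeting, then, after
    shrinking the interval of times so that no piece of value [phi i0] meets one
    of another value along [x], the times would split into two nonempty
    separated parts, although an interval is connected. *)
Lemma closed_cover_chain {T : topologicalType} (k : nat) (D : 'I_k -> set T)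
    (x : R -> T) (d : R) {W : Type} (phi : 'I_k -> W) :
  0 < d -> (forall i, closed (D i)) ->
  (forall t, 0 < t < d -> {for t, continuous x}) ->
  (forall t, 0 < t < d ->
    exists i, D i (x t) /\ frequently (fun s => D i (x s))) ->
  (forall i j, frequently (fun t => D i (x t) /\ D j (x t)) -> phi i = phi j) ->
  forall i j,
  frequently (fun t => D i (x t)) -> frequently (fun t => D j (x t)) ->
  phi i = phi j.
Proof.
move=> d0 clD xc cover edge i0 j0 fi0 fj0; apply: contrapT => nij.
have : \forall t \near 0^'+, forall ij : 'I_k * 'I_k, phi ij.1 <> phi ij.2 ->
    ~ (D ij.1 (x t) /\ D ij.2 (x t)).
  apply: filter_forall => -[i j] /=.
  have [pij|pij] := pselect (phi i = phi j); first by apply: nearW.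
  have : ~ frequently (fun t => D i (x t) /\ D j (x t)) by move=> /edge.
  by move=> /not_frequently; apply: filterS.
move=> /near0rP[e e0 disj].
pose d' := Num.min d e; have d'0 : 0 < d' by rewrite lt_min d0.
pose E (b : bool) : set R := [set t | 0 < t < d' /\
  exists i, D i (x t) /\ ((phi i = phi i0) <-> b)].
have sub (t : R) : 0 < t < d' -> 0 < t < d /\ 0 < t < e.
  by rewrite lt_min => /and3P[-> -> ->].
have E_closed b (t : R) : 0 < t < d' -> closure (E b) t -> E b t.
  move=> td clE; split=> //; apply: contrapT => nD.
  have : \forall s \near t, forall i, ((phi i = phi i0) <-> b) -> ~ D i (x s).
    refine (@filter_forall R 'I_k
      (fun i s => (phi i = phi i0 <-> b) -> ~ D i (x s)) (nbhs t) _ _) => i.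
    have [pb|pb] := pselect ((phi i = phi i0) <-> b); last by apply: nearW.
    have nDi : ~ D i (x t) by move=> Di; apply: nD; exists i.
    have : \forall y \near x t, ~ D i y.
      by apply: (@open_nbhs_nbhs _ _ (~` D i)); split=> //; exact/closed_openC.
    move=> /(xc t (sub t td).1) h.
    by refine (@filterS R (nbhs t) _ _ _ _ h) => s nDs _; exact: nDs.
  move=> /clE[s [[_ [i [Dis pb]]]]] /(_ i pb); exact.
have disjE t : E false t -> E true t -> False.
  move=> [td [i [Di pi]]] [_ [j [Dj pj]]].
  have nji : phi j <> phi i by rewrite (pj.2 isT) => /esym /pi.1.
  exact: (disj t (sub t td).2 (j, i) nji (conj Dj Di)).
have conn : connected `]0, d'[%classic.
  exact/connected_intervalP/interval_is_interval.
move/connectedP: conn => /(_ E); apply; split.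
- case.
    have [t [td Dt]] := fi0 _ d'0; exists t; split=> //; exists i0; split=> //.
  have [t [td Dt]] := fj0 _ d'0; exists t; split=> //; exists j0; split=> //.
  by split=> // /esym.
- apply/seteqP; split=> t; last by case=> -[td _]; rewrite /= in_itv.
  rewrite /= in_itv /= => td; have [i [Di _]] := cover t (sub t td).1.
  have [pi|pi] := pselect (phi i = phi i0); [right|left]; split=> //; exists i => //.
- split; apply/seteqP; split=> // t [h1 h2]; apply: (@disjE t) => //.
    by apply: E_closed => //; case: h2.
  by apply: E_closed => //; case: h1.
Qed.

Lemma poly_eq_deriv (q1 q2 : {poly R}) :
  q1^`() = q2^`() -> q1.[0] = q2.[0] -> q1 = q2.
Proof.
rewrite !horner_coef0 => dq q0; apply/polyP => -[//|i].
have : (q1^`())`_i = (q2^`())`_i by rewrite dq.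
by rewrite !coef_deriv => /eqP; rewrite eqrMn2r /= => /eqP.
Qed.

End SmallTimes.

(** * Curves driven by finitely many analytic pieces *)

(** The analytic field [g i] governs the curve [x] while it is in [D i], and
    [P i N] is the approximate solution of order [N] for [g i]. The number [d]
    is a time before which the bounds of [approx_solvable] and the absorption
    in [short_time_gronwall] are all available. *)
Section Pieces.
Context {R : realType} {n k : nat}.
Variables (D : 'I_k -> set 'rV[R]_n) (V : 'rV[R]_n -> 'rV[R]_n) (x : R -> 'rV[R]_n).
Variables (g : 'I_k -> 'rV[R]_n -> 'rV[R]_n) (C d : R).
Variable (P : 'I_k -> nat -> 'I_n -> {poly R}).
Hypotheses (C1 : 1 <= C) (d0 : 0 < d) (CCd : C * (C * d) <= 1) (Cd : C * d <= 1 / 2).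

Let visited i := frequently (fun t => D i (x t)).
Let velocity i N := poly_curve (fun l => (P i N l)^`()).

Hypotheses
  (D_closed : forall i, closed (D i))
  (x_deriv : forall t, 0 <= t <= d -> is_derive t 1 x (V (x t)))
  (x_near : forall t, 0 <= t <= d -> C * `|x t - x 0| <= 1)
  (x_cover : forall t, 0 < t <= d -> exists i, D i (x t) /\ visited i)
  (V_eq : forall t i, 0 < t <= d -> D i (x t) -> V (x t) = g i (x t))
  (g_lip : forall i, visited i -> forall y z, C * `|y - x 0| <= 1 ->
    C * `|z - x 0| <= 1 -> `|g i y - g i z| <= C * `|y - z|)
  (P_size : forall i N l, visited i -> (size (P i N l) <= N.+1)%N)
  (P_near : forall i N t, visited i -> 0 <= t <= d ->
    `|poly_curve (P i N) t - x 0| <= C * t)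
  (P_solves : forall i N t, visited i -> 0 <= t <= d ->
    `|velocity i N t - g i (poly_curve (P i N) t)| <= C * (C * t) ^+ N).

Let C0 : 0 <= C. Proof. exact: le_trans C1. Qed.

Let Ct_le1 t : 0 <= t <= d -> 0 <= C * t <= 1.
Proof.
move=> /andP[t0 td]; rewrite mulr_ge0 //=.
by rewrite (le_trans (ler_wpM2l C0 td)) // (le_trans Cd) //; lra.
Qed.

Let P_start i N : visited i -> poly_curve (P i N) 0 = x 0.
Proof.
move=> Si; apply/eqP; have := @P_near i N 0 Si.
by rewrite mulr0 normr_le0 subr_eq0; apply; rewrite lexx ltW.
Qed.

Let P_lip_domain i N t : visited i -> 0 <= t <= d ->
  C * `|poly_curve (P i N) t - x 0| <= 1.
Proof.
move=> Si td; case/andP: (td) => t0 td'; apply: le_trans CCd.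
rewrite ler_wpM2l // (le_trans (P_near N Si td)) // ler_wpM2l //.
Qed.

Let phi (K : R) N (t : R) := K * (C * t) ^+ N.

Let phi_ge0 K N t : 0 <= K -> 0 <= t <= d -> 0 <= phi K N t.
Proof. by move=> K0 /Ct_le1/andP[h _]; rewrite mulr_ge0 // exprn_ge0. Qed.

Let phi_mono K N s t : 0 <= K -> 0 <= s -> s <= t <= d -> phi K N s <= phi K N t.
Proof.
move=> K0 s0 /andP[st td]; rewrite ler_wpM2l // lerXn2r ?nnegrE ?mulr_ge0 //.
  exact: le_trans st.
exact: ler_wpM2l.
Qed.

(** At each time the curve follows the field of some visited piece [j], and
    [P i N] is an approximate solution for that piece too, as it equals
    [P j N]. *)
Lemma common_jet_approximates i N : visited i ->
  (forall j, visited j -> P j N = P i N) ->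
  forall t, 0 <= t <= d ->
    `|x t - poly_curve (P i N) t| <= 2 * t * (C * (C * t) ^+ N).
Proof.
move=> Si PN t td.
pose z s := x s - poly_curve (P i N) s; pose z' s := V (x s) - velocity i N s.
apply: (@short_time_gronwall _ _ z z' (phi C N) C d) => //.
- by rewrite /z P_start // subrr.
- by move=> s sd; apply: is_deriveB; [exact: x_deriv|exact: is_derive_poly_curve].
- move=> s /andP[s0 sd]; have sd0 : 0 <= s <= d by rewrite ltW.
  have [|j [Dj Sj]] := @x_cover s; first by rewrite s0.
  rewrite /z' (V_eq _ Dj) ?s0 // -(subrKA (g j (poly_curve (P i N) s))).
  rewrite (le_trans (ler_normD _ _)) // lerD //.
    by apply: g_lip => //; [exact: x_near|exact: P_lip_domain].
  rewrite distrC /velocity -(PN j Sj); exact: P_solves.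
- by move=> s; exact: phi_ge0.
- by move=> s s'; exact: phi_mono.
Qed.

(** Both are approximate solutions of order [N] for the same field. *)
Lemma consecutive_jets_close i N : visited i -> forall t, 0 <= t <= d ->
  `|poly_curve (P i N.+1) t - poly_curve (P i N) t|
    <= 2 * t * (2 * C * (C * t) ^+ N).
Proof.
move=> Si t td.
pose z s := poly_curve (P i N.+1) s - poly_curve (P i N) s.
pose z' s := velocity i N.+1 s - velocity i N s.
have C2 : 0 <= 2 * C by rewrite mulr_ge0.
apply: (@short_time_gronwall _ _ z z' (phi (2 * C) N) C d) => //.
- by rewrite /z !P_start // subrr.
- by move=> s sd; apply: is_deriveB; exact: is_derive_poly_curve.
- move=> s /andP[s0 sd]; have sd0 : 0 <= s <= d by rewrite ltW.
  have h1 := P_solves N.+1 Si sd0; have h2 := P_solves N Si sd0.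
  have h3 := g_lip Si (P_lip_domain N.+1 Si sd0) (P_lip_domain N Si sd0).
  have /andP[Cs0 Cs1] := Ct_le1 sd0.
  have h4 : C * (C * s) ^+ N.+1 <= C * (C * s) ^+ N.
    by rewrite ler_wpM2l // ler_wiXn2l.
  set v := velocity i N s in h2 *; set u := velocity i N.+1 s in h1 *.
  have := ler_distD (g i (poly_curve (P i N.+1) s)) u v.
  have := ler_distD (g i (poly_curve (P i N) s))
    (g i (poly_curve (P i N.+1) s)) v.
  rewrite distrC in h2; rewrite /z /z' -/v -/u /phi; lra.
- by move=> s; exact: phi_ge0.
- by move=> s s'; exact: phi_mono.
Qed.

(** Two visited pieces met along a common sequence of times tending to [0] have
    the same velocity polynomial of order [N.+1], as both are within
    [O(t ^ N.+1)] of [V (x t)] and have degree at most [N]; other pairs are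
    reached by [closed_cover_chain]. *)
Lemma jets_agree N i j : visited i -> visited j -> P i N = P j N.
Proof.
have agree_at M i' j' : visited i' -> visited j' ->
    (forall l, (P i' M l)^`() = (P j' M l)^`()) -> P i' M = P j' M.
  move=> Si Sj dP; apply/funext => l; apply: poly_eq_deriv => //.
  have /rowP/(_ l) : poly_curve (P i' M) 0 = poly_curve (P j' M) 0.
    by rewrite !P_start.
  by rewrite !mxE.
elim: N i j => [|N IH] i j.
  move=> Si Sj; apply: agree_at => // l.
  by rewrite (size1_polyC (P_size 0 l Si)) (size1_polyC (P_size 0 l Sj)) !derivC.
apply: (@closed_cover_chain R _ k D x d _ (fun i => P i N.+1) d0 D_closed).
- move=> t /andP[t0 td]; have [|xt _] := @x_deriv t; first by rewrite !ltW.
  by apply: differentiable_continuous; exact/derivable1_diffP.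
- by move=> t /andP[t0 td]; apply: x_cover; rewrite t0 ltW.
move=> {}i {}j fij.
have Si : visited i by move=> e /fij[t [te [Di _]]]; exists t.
have Sj : visited j by move=> e /fij[t [te [_ Dj]]]; exists t.
apply: agree_at => // l; apply/eqP; rewrite -subr_eq0; apply/eqP.
(* On each of the two sides: 1 from the defect of [P i N.+1], 4 from its distance
   to [P i N], and 2 from the distance of [P i N] to the curve. *)
pose K := 14 * C * C ^+ N.+1.
apply: (@poly_frequently_small R _ N.+1 K).
- by rewrite mulr_ge0 ?exprn_ge0 // mulr_ge0.
- rewrite (leq_trans (size_polyD _ _)) // geq_max size_polyN.
  have sz (q : {poly R}) : (size q <= N.+2)%N -> (size q^`() <= N.+1)%N.
    have [->|/lt_size_deriv qq qN] := eqVneq q 0.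
      by rewrite deriv0 size_poly0.
    by rewrite -ltnS (leq_trans qq).
  by rewrite !sz // P_size.
move=> e e0; have [|t [/andP[t0 te] [Di Dj]]] := fij (Num.min e d).
  by rewrite lt_min e0.
move: te; rewrite lt_min => /andP[te td].
exists t; split; first by rewrite t0.
have tpd : 0 < t <= d by rewrite t0 ltW.
have td0 : 0 <= t <= d by rewrite !ltW.
have /andP[Ct0 Ct1] := Ct_le1 td0.
have bound i' : visited i' -> D i' (x t) ->
    `|velocity i' N.+1 t - V (x t)| <= 7 * C * (C * t) ^+ N.+1.
  move=> Si' Di'; rewrite (V_eq tpd Di') //.
  have h1 := P_solves N.+1 Si' td0.
  have h2 := g_lip Si' (P_lip_domain N.+1 Si' td0) (x_near td0).
  have h3 := consecutive_jets_close N Si' td0.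
  have h4 := common_jet_approximates Si' (fun j Sj => IH _ _ Sj Si') td0.
  have h5 : `|poly_curve (P i' N.+1) t - x t| <= 6 * (C * t) ^+ N.+1.
    rewrite -(subrKA (poly_curve (P i' N) t)) (le_trans (ler_normD _ _)) //.
    rewrite distrC in h4; rewrite [X in _ + X]distrC.
    rewrite [(C * t) ^+ N.+1]exprS.
    move: h3 h4; rewrite distrC => h3 h4.
    rewrite (le_trans (lerD h3 h4)) // le_eqVlt.
    by apply/orP; left; apply/eqP; ring.
  rewrite -(subrKA (g i' (poly_curve (P i' N.+1) t))) (le_trans (ler_normD _ _)) //.
  apply: (le_trans (lerD h1 (le_trans h2 (ler_wpM2l C0 h5)))).
  by rewrite le_eqVlt; apply/orP; left; apply/eqP; ring.
have -> : ((P i N.+1 l)^`() - (P j N.+1 l)^`()).[t] =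
    (velocity i N.+1 t - V (x t) - (velocity j N.+1 t - V (x t))) 0 l.
  by rewrite hornerD hornerN !mxE; ring.
apply: le_trans (rV_coord_le _ _) _; apply: le_trans (ler_normB _ _) _.
apply: le_trans (lerD (bound _ Si Di) (bound _ Sj Dj)) _.
by rewrite /K exprMn le_eqVlt; apply/orP; left; apply/eqP; ring.
Qed.

Lemma half_space_sign i (a : 'rV[R]_n) (b : R) : visited i ->
  let f t := \sum_l a 0 l * x t 0 l - b in
  (\forall t \near 0^'+, 0 <= f t) \/ (\forall t \near 0^'+, f t < 0).
Proof.
move=> Si f; pose A := \sum_l `|a 0 l|.
have A0 : 0 <= A by exact: sumr_ge0.
apply: (@eventually_constant_sign R f
  (fun N => \sum_l a 0 l *: P i N l - b%:P) (2 * A) C d) => //.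
- by rewrite mulr_ge0.
- move=> N; rewrite (leq_trans (size_polyD _ _)) // geq_max size_polyN.
  rewrite (leq_trans (size_polyC_leq1 _)) // andbT.
  apply: (leq_trans (size_sum _ _ _)); apply/bigmax_leqP => l _.
  by rewrite (leq_trans (size_scale_leq _ _)) // P_size.
move=> N t td.
have h := common_jet_approximates Si (fun j Sj => jets_agree N Sj Si) td.
have -> : f t - (\sum_l a 0 l *: P i N l - b%:P).[t] =
    \sum_l a 0 l * (x t - poly_curve (P i N) t) 0 l.
  rewrite /f hornerD hornerN hornerC horner_sum opprB addrA subrK -sumrB.
  by apply: eq_bigr => l _; rewrite hornerZ !mxE mulrBr.
rewrite (le_trans (ler_norm_sum _ _ _)) //.
rewrite (_ : 2 * A * _ = A * (2 * t * (C * (C * t) ^+ N))); last first.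
  by rewrite exprS; ring.
rewrite mulr_suml; apply: ler_sum => l _; rewrite normrM ler_wpM2l //.
exact: le_trans (rV_coord_le _ _) h.
Qed.

End Pieces.

Unset Implicit Arguments.

Theorem theorem1p2 (R : realType) (n : nat) (U : set 'rV[R]_n)
    (k : nat) (D : 'I_k -> set 'rV[R]_n)
    (V : 'rV[R]_n -> 'rV[R]_n) (x : R -> 'rV[R]_n)
    (U_open : open U)
    (D_closed : forall i, closed (D i))
    (D_polytope : forall i, convex_polytope (D i))
    (D_cover : U `<=` \bigcup_i D i)
    (V_C1 : C1_on V U)
    (V_analytic : forall i, analytic_on V (D i `&` U))
    (x_curve : \forall t \near (0 : R), U (x t) /\ is_derive t 1 x (V (x t))) :
  exists2 e : R, 0 < e & exists i, x @` `[0, e[ `<=` D i.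
Proof.
have [U0 dx0] := nbhs_singleton x_curve.
have xc0 : {for 0, continuous x}.
  have [xt _] := dx0.
  by apply: differentiable_continuous; exact/derivable1_diffP.
pose visited i := frequently (fun t => D i (x t)).
have SD i : visited i -> D i (x 0).
  move=> Si; apply: contrapT => nDi.
  have : \forall y \near x 0, ~ D i y.
    by apply: (@open_nbhs_nbhs _ _ (~` D i)); split=> //; exact/closed_openC.
  move=> /xc0/nbhs_ballP[e /= e0 eD]; have [t [/andP[t0 te]]] := Si e e0.
  by apply: eD; rewrite /ball /= sub0r normrN gtr0_norm.
have /choice[g hg] : forall i, exists g, (D i (x 0) -> analytic_at g (x 0)) /\
    forall y, D i y -> U y -> V y = g y.
  move=> i; have [W [g [_ DW ga gV]]] := V_analytic i; exists g; split.
    by move=> Di; apply: ga; exact: DW.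
  by move=> y Dy Uy; rewrite gV.
have /choice[c hc] : forall i, exists c, D i (x 0) -> approx_solvable c (g i) (x 0).
  move=> i; have [Di|nDi] := pselect (D i (x 0)); last by exists 0.
  by have [c hc] := analytic_approx_solvable ((hg i).1 Di); exists c.
(* One constant for all pieces containing the starting point. *)
pose C := 1 + \sum_i `|c i|.
have C1 : 1 <= C by rewrite lerDl sumr_ge0.
have C0 : 0 <= C by exact: le_trans C1.
have hC i : visited i -> approx_solvable C (g i) (x 0).
  move=> /SD/hc; apply: approx_solvable_le; apply: le_trans (ler_norm _) _.
  by rewrite /C (bigD1 i) //= addrCA lerDl addr_ge0 // sumr_ge0.
have /choice[P hP] : forall i,
    exists P : nat -> 'I_n -> {poly R}, forall N, visited i ->
    (forall l, (size (P N l) <= N.+1)%N) /\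
    forall t, 0 <= t -> C * (C * t) <= 1 ->
      `|poly_curve (P N) t - x 0| <= C * t /\
      `|poly_curve (fun l => (P N l)^`()) t - g i (poly_curve (P N) t)|
          <= C * (C * t) ^+ N.
  move=> i; have [Si|nSi] := pselect (visited i); last by exists (fun _ _ => 0).
  have [_ _ /choice[P hP]] := hC i Si; exists P => N _; exact: hP.
have : \forall t \near 0^'+, [/\ U (x t) /\ is_derive t 1 x (V (x t)),
    C * `|x t - x 0| <= 1 & forall i, D i (x t) -> visited i].
  have e1 : \forall t \near 0^'+, U (x t) /\ is_derive t 1 x (V (x t)).
    exact: cvg_within x_curve.
  have e2 : \forall t \near 0^'+, C * `|x t - x 0| <= 1.
    have /cvgrPdist_le/(_ C^-1) := xc0; rewrite invr_gt0 (lt_le_trans ltr01 C1).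
    move=> /(_ isT) h; apply: cvg_within.
    apply: filterS h => t; rewrite distrC => h.
    by rewrite -ler_pdivlMl ?mulr1 // (lt_le_trans ltr01).
  have e3 : \forall t \near 0^'+, forall i, D i (x t) -> visited i.
    apply: filter_forall => i.
    have [Si|/not_frequently] := pselect (visited i); first exact: nearW.
    by apply: filterS => t nD Dt.
  by apply: filterS3 e1 e2 e3.
move=> /near0rP[e e0 he].
pose d := Num.min (e / 2) (1 / (2 * (C * C))).
have Cp : 0 < C by exact: lt_le_trans C1.
have d0 : 0 < d by rewrite lt_min !divr_gt0 ?mulr_gt0.
have CCd : C * (C * d) <= 1 / 2.
  rewrite mulrA mulrC -ler_pdivlMr ?mulr_gt0 // ge_min; apply/orP; right.
  by rewrite le_eqVlt; apply/orP; left; apply/eqP; field; rewrite lt0r_neq0.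
have Cd : C * d <= 1 / 2.
  by apply: le_trans CCd; rewrite ler_peMl // mulr_ge0 // ltW.
have CCd1 : C * (C * d) <= 1 by rewrite (le_trans CCd) //; lra.
have de t : 0 < t <= d -> 0 < t < e.
  by move=> /andP[-> /le_lt_trans]; apply; rewrite gt_min; apply/orP; left; lra.
have tCC t : 0 <= t <= d -> C * (C * t) <= 1.
  move=> /andP[_ td]; apply: le_trans CCd1; rewrite ler_wpM2l // ler_wpM2l //.
have x_cover t : 0 < t <= d -> exists i, D i (x t) /\ visited i.
  move=> /de/he[[Ut _] _ h]; have [i _ Di] := D_cover _ Ut.
  by exists i; split => //; exact: h.
have sign := @half_space_sign R n k D V x g C d P C1 d0 CCd1 Cd D_closed.
have [|i [_ Si]] := x_cover d; first by rewrite d0 lexx.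
have {}sign (a : 'rV[R]_n) (b : R) :
    (\forall t \near 0^'+, 0 <= \sum_l a 0 l * x t 0 l - b) \/
    (\forall t \near 0^'+, \sum_l a 0 l * x t 0 l - b < 0).
  apply: (sign _ _ x_cover _ _ _ _ _ i a b Si).
  - move=> t /andP[t0 td]; have [<-//|t00] := eqVneq 0 t.
    by have [|[_ xt] _ _] := he t; first by apply: de; rewrite lt_def eq_sym t00 t0.
  - move=> t /andP[t0 td]; have [<-|t00] := eqVneq 0 t.
      by rewrite subrr normr0 mulr0.
    by have [|_ -> _] := he t; first by apply: de; rewrite lt_def eq_sym t00 t0.
  - by move=> t j /de/he[[Ut _] _ _] Dj; exact: (hg j).2.
  - by move=> j /hC[].
  - by move=> j N l /(hP j N)[].
  - by move=> j N t /(hP j N)[_ h] /[dup] /tCC Ct /andP[t0 _]; case: (h t t0 Ct).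
  - by move=> j N t /(hP j N)[_ h] /[dup] /tCC Ct /andP[t0 _]; case: (h t t0 Ct).
have [_ [m [H [hH DE]]]] := D_polytope i.
have : \forall t \near 0^'+, forall j, H j (x t).
  apply: filter_forall => j; have [a [b [_ HE]]] := hH j.
  have [pos|neg] := sign a b.
    by apply: filterS pos => t; rewrite HE /= subr_ge0.
  have /(_ 1 ltr01)[t [_ [Dt]]] := frequently_near Si neg.
  move: Dt; rewrite DE => /(_ j I); rewrite HE /= subr_lt0 => h1 h2; lra.
move=> /near0rP[r r0 hr]; exists r => //; exists i => _ [t /= + <-].
rewrite in_itv /= => /andP[t0 tr]; have [<-|t00] := eqVneq 0 t; first exact: SD.
by rewrite DE => j _; apply: hr; rewrite lt_def eq_sym t00 t0.
Qed.
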